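(* Let $(\gamma,\widetilde\gamma)$ be a non-helical and non-planar Bertrand pair in Euclidean 3-space, parameterized by the arclengths $s$ and $s^{*}$ respectively ($\gamma$ the Bertrand curve, $\widetilde\gamma$ its mate). Then: (i) the Bertrand curve $\gamma$ is a slant helix if and only if the tangent indicatrix $\gamma_t=T$ of $\gamma$ is a spherical helix; (ii) the Bertrand mate curve $\widetilde\gamma$ is a slant helix if and only if the tangent indicatrix $\gamma_t=T$ of $\gamma$ is a spherical helix.
   Context: Curves are smooth regular curves in $\mathbb{R}^3$ with non-vanishing curvature; $\gamma$ has Frenet frame $T,N,B$, curvature $\kappa$, torsion $\tau$, and $\widetilde\gamma$ has $\widetilde T,\widetilde N,\widetilde B,\widetilde\kappa,\widetilde\tau$. The pair $(\gamma,\widetilde\gamma)$ is a Bertrand pair if there is a correspondence of points such that the principal normals at corresponding points are linearly dependent, $N=\epsilon\widetilde N$ with $\epsilon=\pm1$, and $\widetilde\gamma(s^{*})=\gamma(s)+\lambda N(s)$ with $\lambda\neq0$ constant. Non-helical means that torsion/curvature of each curve is not constant, non-planar that the torsions are non-zero; the quotients $\tau/\kappa$, $\tau'/\kappa'$, $\widetilde\tau/\widetilde\kappa$, $\widetilde\tau'/\widetilde\kappa'$ are assumed to be defined (denominators non-zero, and the two quotients of each curve different and non-zero at each point). A slant helix is a curve whose principal normal lines make a constant angle with a fixed straight line. The tangent indicatrix of $\gamma$ is the curve $s\mapsto T(s)$ on the unit sphere. A spherical helix is a curve on the sphere which is a (general) helix, i.e. the ratio of its torsion to its curvature is constant. *)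

(* Defs.v *)
From Stdlib Require Import Reals.
From Coquelicot Require Import Coquelicot.
Open Scope R_scope.

(** [plus], [scal] and [zero] on [R3] are those of Coquelicot's product
    modules, hence componentwise. *)
Definition R3 : Type := (R * R * R)%type.

Definition cx (v : R3) : R := fst (fst v).
Definition cy (v : R3) : R := snd (fst v).
Definition cz (v : R3) : R := snd v.

Definition dot (u v : R3) : R := cx u * cx v + cy u * cy v + cz u * cz v.

Definition len (v : R3) : R := sqrt (dot v v).

Definition cross (u v : R3) : R3 :=
  (cy u * cz v - cz u * cy v,
   cz u * cx v - cx u * cz v,
   cx u * cy v - cy u * cx v).

(** A curve is a total function [R -> R3] considered only on an open interval,
    bounded or not; its values elsewhere are irrelevant to everything below. *)
Definition oint (a b : Rbar) (t : R) : Prop := Rbar_lt a t /\ Rbar_lt t b.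

Definition vderive (c : R -> R3) (t : R) : R3 :=
  (Derive (fun x => cx (c x)) t,
   Derive (fun x => cy (c x)) t,
   Derive (fun x => cz (c x)) t).

Definition smooth (D : R -> Prop) (c : R -> R3) : Prop :=
  forall (n : nat) (t : R), D t ->
    ex_derive_n (fun x => cx (c x)) n t /\
    ex_derive_n (fun x => cy (c x)) n t /\
    ex_derive_n (fun x => cz (c x)) n t.

(** Frenet apparatus of a regular curve in an arbitrary parameter [t]:
    differentiation with respect to arclength is [1 / len (vderive c t)] times
    differentiation with respect to [t]. The general parameter is needed because
    the tangent indicatrix of a unit speed curve is not itself unit speed. The
    sign of the torsion is that of [B' = - tau N]. *)
Definition speed (c : R -> R3) (t : R) : R := len (vderive c t).

Definition tangent (c : R -> R3) (t : R) : R3 :=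
  scal (/ speed c t) (vderive c t).

Definition normal (c : R -> R3) (t : R) : R3 :=
  scal (/ len (vderive (tangent c) t)) (vderive (tangent c) t).

Definition binormal (c : R -> R3) (t : R) : R3 :=
  cross (tangent c t) (normal c t).

Definition curvature (c : R -> R3) (t : R) : R :=
  len (vderive (tangent c) t) / speed c t.

Definition torsion (c : R -> R3) (t : R) : R :=
  - dot (vderive (binormal c) t) (normal c t) / speed c t.

Definition frenet_curve (D : R -> Prop) (c : R -> R3) : Prop :=
  smooth D c /\
  (forall t, D t -> vderive c t <> zero) /\
  (forall t, D t -> curvature c t <> 0).

Definition unit_speed (D : R -> Prop) (c : R -> R3) : Prop :=
  forall t, D t -> speed c t = 1.

Definition general_helix (D : R -> Prop) (c : R -> R3) : Prop :=
  exists k : R, forall t, D t -> torsion c t / curvature c t = k.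

Definition non_planar (D : R -> Prop) (c : R -> R3) : Prop :=
  forall t, D t -> torsion c t <> 0.

(** For a unit speed curve: [tau / kappa] and [tau' / kappa'] are defined,
    non-zero and different at each point. *)
Definition admissible_quotients (D : R -> Prop) (c : R -> R3) : Prop :=
  forall t, D t ->
    curvature c t <> 0 /\
    Derive (curvature c) t <> 0 /\
    torsion c t / curvature c t <> 0 /\
    Derive (torsion c) t / Derive (curvature c) t <> 0 /\
    torsion c t / curvature c t
      <> Derive (torsion c) t / Derive (curvature c) t.

(** The correspondence [s |-> s*] is the bijection [phi]; no regularity of [phi]
    is imposed. *)
Definition bertrand_pair (D : R -> Prop) (c : R -> R3)
    (E : R -> Prop) (m : R -> R3) : Prop :=
  exists (phi : R -> R) (lambda eps : R),
    (forall s, D s -> E (phi s)) /\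
    (forall t, E t -> exists! s, D s /\ phi s = t) /\
    lambda <> 0 /\
    (eps = 1 \/ eps = -1) /\
    (forall s, D s -> normal c s = scal eps (normal m (phi s))) /\
    (forall s, D s -> m (phi s) = plus (c s) (scal lambda (normal c s))).

(** Angle in [[0, PI/2]] between two (unoriented) lines with non-zero direction
    vectors [u] and [v]. *)
Definition line_angle (u v : R3) : R :=
  acos (Rabs (dot u v) / (len u * len v)).

Definition slant_helix (D : R -> Prop) (c : R -> R3) : Prop :=
  frenet_curve D c /\
  exists (u : R3) (theta : R),
    u <> zero /\ forall t, D t -> line_angle (normal c t) u = theta.

Definition tangent_indicatrix (c : R -> R3) : R -> R3 := fun s => tangent c s.

Definition spherical_helix (D : R -> Prop) (c : R -> R3) : Prop :=
  frenet_curve D c /\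
  (forall t, D t -> len (c t) = 1) /\
  general_helix D c.

(* Main.v *)
Require Import Defs.
From Stdlib Require Import Reals.
From Coquelicot Require Import Coquelicot.
From Stdlib Require Import Lra.
Open Scope R_scope.

(** The principal normal of [gamma] is the unit tangent of its tangent
    indicatrix, so slant helicity of [gamma] says that the tangent of the
    indicatrix makes a constant angle with a fixed line; by Lancret's theorem
    this is constancy of torsion over curvature. Corresponding principal normals
    of a Bertrand pair agree up to sign and so span the same line, so that
    [gamma] and its mate are slant helices simultaneously. *)

(** * Smooth scalar functions *)

(** Existence of [n] successive derivatives at the points of [D]. The recursion passes to [Derive f]
    at the inside, so that inductions on [n] can generalise over [f] and use the rules for first
    derivatives; [Derive_n] iterates at the outside. *)
Fixpoint Ck (D : R -> Prop) (n : nat) (f : R -> R) : Prop :=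
  match n with
  | O => True
  | S k => (forall t, D t -> ex_derive f t) /\ Ck D k (Derive f)
  end.

Definition Cinf (D : R -> Prop) (f : R -> R) : Prop := forall n, Ck D n f.

Lemma Derive_n_Derive (f : R -> R) (n : nat) (t : R) :
  Derive_n (Derive f) n t = Derive_n f (S n) t.
Proof.
  revert t; induction n as [|n IH]; intros t; [reflexivity|].
  change (Derive (Derive_n (Derive f) n) t = Derive (Derive_n f (S n)) t).
  now apply Derive_ext.
Qed.

(** The shift starts at order two because [ex_derive_n] of order 0 is [True], whereas order 1 is a
    genuine condition on [f]. *)
Lemma ex_derive_n_Derive (f : R -> R) (n : nat) (t : R) :
  ex_derive_n f (S (S n)) t <-> ex_derive_n (Derive f) (S n) t.
Proof.
  change (ex_derive (Derive_n f (S n)) t <-> ex_derive (Derive_n (Derive f) n) t).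
  split; apply ex_derive_ext; intros x; now rewrite Derive_n_Derive.
Qed.

Lemma Cinf_ex_derive_n (D : R -> Prop) (f : R -> R) :
  Cinf D f <-> forall n t, D t -> ex_derive_n f n t.
Proof.
  split.
  - intros H n. specialize (H n). revert f H.
    induction n as [|n IH]; intros f H t Dt; [exact I|].
    destruct H as [H1 H2]; destruct n as [|n]; [now apply H1|].
    apply (proj2 (ex_derive_n_Derive f n t)); now apply IH.
  - intros H n. revert f H.
    induction n as [|n IH]; intros f H; simpl; [exact I|].
    split.
    + intros t Dt; exact (H 1%nat t Dt).
    + apply IH; intros [|m] t Dt; [exact I|].
      apply (proj1 (ex_derive_n_Derive f m t)), H, Dt.
Qed.

Lemma Ck_S (D : R -> Prop) (n : nat) (f : R -> R) : Ck D (S n) f -> Ck D n f.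
Proof.
  revert f; induction n as [|n IH]; intros f [H1 H2]; [exact I|].
  split; [exact H1 | now apply IH].
Qed.

(** Since [D] is open, agreement on [D] is agreement near each of its points and passes to
    derivatives. Derivative formulas thus need to hold only on [D]. *)
Lemma Ck_ext (D : R -> Prop) (oD : open D) (n : nat) (f g : R -> R) :
  (forall t, D t -> f t = g t) -> Ck D n f -> Ck D n g.
Proof.
  revert f g; induction n as [|n IH]; intros f g E H; [exact I|].
  assert (L : forall t, D t -> locally t (fun x => f x = g x)).
  { intros t Dt; generalize (oD t Dt); now apply filter_imp. }
  destruct H as [H1 H2]; split.
  - intros t Dt; apply ex_derive_ext_loc with f; auto.
  - apply IH with (Derive f); [|exact H2].
    intros t Dt; apply Derive_ext_loc; auto.
Qed.

Lemma Ck_const (D : R -> Prop) (n : nat) (a : R) : Ck D n (fun _ => a).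
Proof.
  revert a; induction n as [|n IH]; intros a; [exact I|]; split.
  - intros t _; apply ex_derive_const.
  (* The derivative of a constant is only pointwise equal to zero, so a second induction runs over
     all functions that vanish pointwise. *)
  - enough (H : forall f, (forall t, f t = 0) -> Ck D n f)
      by (apply H; intros t; apply Derive_const).
    clear IH a; induction n as [|n IH]; intros f E; [exact I|]; split.
    + intros t _; apply ex_derive_ext with (fun _ => 0); [easy|].
      apply ex_derive_const.
    + apply IH; intros t; rewrite (Derive_ext f (fun _ => 0)) by exact E.
      apply Derive_const.
Qed.

Lemma Ck_plus (D : R -> Prop) (oD : open D) (n : nat) (f g : R -> R) :
  Ck D n f -> Ck D n g -> Ck D n (fun t => f t + g t).
Proof.
  revert f g; induction n as [|n IH]; intros f g Hf Hg; [exact I|].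
  destruct Hf as [F1 F2], Hg as [G1 G2]; split.
  - intros t Dt; apply @ex_derive_plus; auto.
  - apply Ck_ext with (fun t => Derive f t + Derive g t); auto.
    intros t Dt; symmetry; apply Derive_plus; auto.
Qed.

Lemma Ck_mult (D : R -> Prop) (oD : open D) (n : nat) (f g : R -> R) :
  Ck D n f -> Ck D n g -> Ck D n (fun t => f t * g t).
Proof.
  revert f g; induction n as [|n IH]; intros f g Hf Hg; [exact I|].
  (* The Leibniz rule also involves [f] and [g] undifferentiated, at the lower order [n]. *)
  pose proof (Ck_S _ _ _ Hf); pose proof (Ck_S _ _ _ Hg).
  destruct Hf as [F1 F2], Hg as [G1 G2]; split.
  - intros t Dt; apply @ex_derive_mult; auto.
  - apply Ck_ext with (fun t => Derive f t * g t + f t * Derive g t); auto.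
    + intros t Dt; symmetry; apply Derive_mult; auto.
    + apply Ck_plus; auto.
Qed.

(** The derivative is a product of [Derive f] with two copies of [/ f], to which the induction
    hypothesis for the same [f] applies. The square root below is treated likewise. *)
Lemma Ck_inv (D : R -> Prop) (oD : open D) (n : nat) (f : R -> R) :
  (forall t, D t -> f t <> 0) -> Ck D n f -> Ck D n (fun t => / f t).
Proof.
  intros nz; induction n as [|n IH]; intros Hf; [exact I|].
  pose proof (IH (Ck_S _ _ _ Hf)) as Hi.
  destruct Hf as [F1 F2]; split.
  - intros t Dt; apply ex_derive_inv; auto.
  - apply Ck_ext with (fun t => -1 * Derive f t * (/ f t * / f t)); auto.
    + intros t Dt; rewrite Derive_inv by auto; field; auto.
    + repeat apply Ck_mult; auto using Ck_const.
Qed.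

Lemma Ck_sqrt (D : R -> Prop) (oD : open D) (n : nat) (f : R -> R) :
  (forall t, D t -> 0 < f t) -> Ck D n f -> Ck D n (fun t => sqrt (f t)).
Proof.
  intros pos; induction n as [|n IH]; intros Hf; [exact I|].
  pose proof (IH (Ck_S _ _ _ Hf)) as Hs.
  destruct Hf as [F1 F2].
  assert (Hd : forall t, D t ->
    is_derive (fun x => sqrt (f x)) t (Derive f t / (2 * sqrt (f t)))).
  { intros t Dt; apply is_derive_sqrt; auto; apply Derive_correct; auto. }
  split.
  - intros t Dt; eexists; now apply Hd.
  - apply Ck_ext with (fun t => / 2 * Derive f t * / sqrt (f t)); auto.
    + intros t Dt; symmetry; etransitivity;
        [apply (is_derive_unique _ _ _ (Hd t Dt))|].
      field; apply Rgt_not_eq, sqrt_lt_R0; auto.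
    + repeat apply Ck_mult; auto using Ck_const.
      apply Ck_inv; auto.
      intros t Dt; apply Rgt_not_eq, sqrt_lt_R0; auto.
Qed.

(** * Smooth curves *)

Definition Cinf3 (D : R -> Prop) (c : R -> R3) : Prop :=
  Cinf D (fun x => cx (c x)) /\ Cinf D (fun x => cy (c x)) /\
  Cinf D (fun x => cz (c x)).

Lemma smooth_Cinf3 (D : R -> Prop) (c : R -> R3) : smooth D c <-> Cinf3 D c.
Proof.
  unfold smooth, Cinf3; rewrite !Cinf_ex_derive_n; split.
  - intros H; repeat split; intros n t Dt; apply (H n t Dt).
  - intros (Hx & Hy & Hz) n t Dt; auto.
Qed.

Lemma smooth_vderive (D : R -> Prop) (c : R -> R3) :
  smooth D c -> smooth D (vderive c).
Proof.
  rewrite !smooth_Cinf3; intros (Hx & Hy & Hz).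
  repeat split; intros n; [apply (Hx (S n)) | apply (Hy (S n)) | apply (Hz (S n))].
Qed.

Lemma Cinf_dot (D : R -> Prop) (oD : open D) (u v : R -> R3) :
  Cinf3 D u -> Cinf3 D v -> Cinf D (fun t => dot (u t) (v t)).
Proof.
  intros (? & ? & ?) (? & ? & ?) n; unfold dot.
  repeat apply Ck_plus; auto; apply Ck_mult; auto.
Qed.

Lemma smooth_cross (D : R -> Prop) (oD : open D) (u v : R -> R3) :
  smooth D u -> smooth D v -> smooth D (fun t => cross (u t) (v t)).
Proof.
  rewrite !smooth_Cinf3; intros (? & ? & ?) (? & ? & ?).
  assert (M : forall f g h k, Cinf D f -> Cinf D g -> Cinf D h -> Cinf D k ->
    Cinf D (fun t => f t * g t - h t * k t)).
  { intros f g h k Hf Hg Hh Hk n.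
    apply Ck_ext with (fun t => f t * g t + -1 * (h t * k t)); auto.
    - intros; ring.
    - apply Ck_plus; auto; repeat apply Ck_mult; auto using Ck_const. }
  split; [|split]; apply M; auto.
Qed.

Lemma is_derive_dot (D : R -> Prop) (u v : R -> R3) (t : R) :
  smooth D u -> smooth D v -> D t ->
  is_derive (fun x => dot (u x) (v x)) t
    (dot (vderive u t) (v t) + dot (u t) (vderive v t)).
Proof.
  intros Su Sv Dt.
  destruct (Su 1%nat t Dt) as (Ux & Uy & Uz), (Sv 1%nat t Dt) as (Vx & Vy & Vz).
  (* Abstracting the six components makes them atomic for [auto_derive]. *)
  assert (P : forall f1 f2 f3 g1 g2 g3 : R -> R,
    ex_derive f1 t -> ex_derive f2 t -> ex_derive f3 t ->
    ex_derive g1 t -> ex_derive g2 t -> ex_derive g3 t ->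
    is_derive (fun x => f1 x * g1 x + f2 x * g2 x + f3 x * g3 x) t
      (Derive f1 t * g1 t + Derive f2 t * g2 t + Derive f3 t * g3 t
       + (f1 t * Derive g1 t + f2 t * Derive g2 t + f3 t * Derive g3 t))).
  { intros; auto_derive; [tauto|].
    repeat match goal with
           | |- context [Derive (fun x => ?f x) t] =>
               progress change (Derive (fun x => f x) t) with (Derive f t)
           end.
    ring. }
  exact (P _ _ _ _ _ _ Ux Uy Uz Vx Vy Vz).
Qed.

(** Applied to the orthonormality relations of the frame, this yields the Frenet equations; applied
    with a constant [v], it differentiates a condition on a fixed axis. *)
Lemma dot_derive_const (D : R -> Prop) (oD : open D) (u v : R -> R3) (k t : R) :
  smooth D u -> smooth D v -> (forall x, D x -> dot (u x) (v x) = k) -> D t ->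
  dot (vderive u t) (v t) + dot (u t) (vderive v t) = 0.
Proof.
  intros Su Sv E Dt.
  rewrite <- (is_derive_unique _ _ _ (is_derive_dot D u v t Su Sv Dt)).
  rewrite <- (Derive_const k t).
  apply Derive_ext_loc; generalize (oD t Dt); now apply filter_imp.
Qed.

Lemma smooth_const (D : R -> Prop) (u : R3) : smooth D (fun _ => u).
Proof.
  intros n t _; repeat split; apply ex_derive_n_const.
Qed.

Lemma vderive_const (u : R3) (t : R) : vderive (fun _ => u) t = zero.
Proof.
  unfold vderive; now rewrite !Derive_const.
Qed.

(** * Vector algebra *)

Lemma dotC (u v : R3) : dot u v = dot v u.
Proof. unfold dot; ring. Qed.

Lemma dot0r (u : R3) : dot u zero = 0.
Proof.
  unfold dot, zero, cx, cy, cz; simpl; unfold zero; simpl; ring.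
Qed.

Lemma dot_scal_l (k : R) (u v : R3) : dot (scal k u) v = k * dot u v.
Proof.
  destruct u as [[u1 u2] u3].
  unfold dot, cx, cy, cz; simpl; unfold scal; simpl; unfold mult; simpl; ring.
Qed.

Lemma dot_plus_l (u v w : R3) : dot (plus u v) w = dot u w + dot v w.
Proof.
  destruct u as [[u1 u2] u3], v as [[v1 v2] v3].
  unfold dot, cx, cy, cz; simpl; unfold plus; simpl; ring.
Qed.

Lemma dot_ge0 (v : R3) : 0 <= dot v v.
Proof. unfold dot; nra. Qed.

Lemma dot_eq0 (v : R3) : dot v v = 0 -> v = zero.
Proof.
  destruct v as [[x y] z]; unfold dot, cx, cy, cz; simpl; intros H.
  assert (x = 0) by nra; assert (y = 0) by nra; assert (z = 0) by nra.
  now subst.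
Qed.

Lemma dot_gt0 (v : R3) : v <> zero -> 0 < dot v v.
Proof.
  intros nz; destruct (dot_ge0 v) as [H|H]; auto.
  now elim nz; apply dot_eq0.
Qed.

Lemma len_sqr (v : R3) : len v * len v = dot v v.
Proof. apply sqrt_sqrt, dot_ge0. Qed.

Lemma len_gt0 (v : R3) : v <> zero -> 0 < len v.
Proof. intros nz; now apply sqrt_lt_R0, dot_gt0. Qed.

Lemma len_zero : len zero = 0.
Proof. unfold len; rewrite dot0r; apply sqrt_0. Qed.

Lemma Cauchy_Schwarz (u v : R3) : Rabs (dot u v) <= len u * len v.
Proof.
  unfold len; rewrite <- sqrt_mult by apply dot_ge0.
  rewrite <- sqrt_Rsqr_abs; apply sqrt_le_1_alt.
  (* Lagrange's identity. *)
  enough (dot u u * dot v v - Rsqr (dot u v)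
          = dot (cross u v) (cross u v)) by (pose proof (dot_ge0 (cross u v)); lra).
  unfold dot, cross, Rsqr, cx, cy, cz; simpl; ring.
Qed.

Lemma dot_normalize (v : R3) :
  v <> zero -> dot (scal (/ len v) v) (scal (/ len v) v) = 1.
Proof.
  intros nz; pose proof (len_gt0 v nz).
  rewrite dot_scal_l, dotC, dot_scal_l, <- len_sqr; field; lra.
Qed.

Lemma dot_normalize_l (v w : R3) :
  v <> zero -> dot v w = len v * dot (scal (/ len v) v) w.
Proof.
  intros nz; pose proof (len_gt0 v nz); rewrite dot_scal_l; field; lra.
Qed.

Lemma dot_cross_l (u v : R3) : dot (cross u v) u = 0.
Proof. unfold dot, cross, cx, cy, cz; simpl; ring. Qed.

Lemma dot_cross_r (u v : R3) : dot (cross u v) v = 0.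
Proof. unfold dot, cross, cx, cy, cz; simpl; ring. Qed.

(** The product of two triple products is the Gram determinant. *)
Lemma orthonormal_expansion (p q v w : R3) :
  dot p p = 1 -> dot q q = 1 -> dot p q = 0 ->
  dot v w = dot v p * dot w p + dot v q * dot w q
            + dot v (cross p q) * dot w (cross p q).
Proof.
  intros Hp Hq Hpq.
  assert (G : dot v (cross p q) * dot w (cross p q) =
    dot v w * (dot p p * dot q q - dot p q * dot p q)
    - dot v p * (dot w p * dot q q - dot p q * dot w q)
    + dot v q * (dot w p * dot p q - dot p p * dot w q)).
  { unfold dot, cross, cx, cy, cz; simpl; ring. }
  rewrite G, Hp, Hq, Hpq; ring.
Qed.

Lemma dot_cross_cross (p q : R3) :
  dot p p = 1 -> dot q q = 1 -> dot p q = 0 -> dot (cross p q) (cross p q) = 1.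
Proof.
  intros Hp Hq Hpq.
  assert (G : dot (cross p q) (cross p q)
              = dot p p * dot q q - dot p q * dot p q).
  { unfold dot, cross, cx, cy, cz; simpl; ring. }
  rewrite G, Hp, Hq, Hpq; ring.
Qed.

(** * The Frenet frame *)

Lemma smooth_tangent (D : R -> Prop) (oD : open D) (c : R -> R3) :
  smooth D c -> (forall t, D t -> vderive c t <> zero) -> smooth D (tangent c).
Proof.
  intros Sc reg; apply smooth_Cinf3.
  assert (S' : Cinf3 D (vderive c)) by now apply smooth_Cinf3, smooth_vderive.
  assert (Si : Cinf D (fun t => / speed c t)).
  { intros n; apply Ck_inv; auto.
    - intros t Dt; apply Rgt_not_eq, len_gt0; auto.
    - apply Ck_sqrt; auto.
      + intros t Dt; apply dot_gt0; auto.
      + now apply Cinf_dot. }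
  destruct S' as (Sx & Sy & Sz).
  split; [|split]; intros n; apply (Ck_mult D oD n (fun t => / speed c t)); auto.
Qed.

Lemma vderive_tangent_neq0 (D : R -> Prop) (c : R -> R3) (t : R) :
  frenet_curve D c -> D t -> vderive (tangent c) t <> zero.
Proof.
  intros (_ & _ & K) Dt E; apply (K t Dt).
  unfold curvature; rewrite E, len_zero; apply Rmult_0_l.
Qed.

Lemma tangent_unit (D : R -> Prop) (c : R -> R3) (t : R) :
  frenet_curve D c -> D t -> dot (tangent c t) (tangent c t) = 1.
Proof. intros (_ & reg & _) Dt; apply dot_normalize; auto. Qed.

Lemma normal_unit (D : R -> Prop) (c : R -> R3) (t : R) :
  frenet_curve D c -> D t -> dot (normal c t) (normal c t) = 1.
Proof.
  intros F Dt; apply dot_normalize; now apply vderive_tangent_neq0 with D.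
Qed.

Lemma frenet_smooth_tangent (D : R -> Prop) (oD : open D) (c : R -> R3) :
  frenet_curve D c -> smooth D (tangent c).
Proof. intros (Sc & reg & _); now apply smooth_tangent. Qed.

Lemma frenet_smooth_normal (D : R -> Prop) (oD : open D) (c : R -> R3) :
  frenet_curve D c -> smooth D (normal c).
Proof.
  (* By unfolding, [normal c] is [tangent (tangent c)]. *)
  intros F; apply (smooth_tangent D oD (tangent c)).
  - now apply frenet_smooth_tangent.
  - intros t Dt; now apply vderive_tangent_neq0 with D.
Qed.

(** First Frenet equation in an arbitrary parameter, tested against a vector [w]. The frame
    equations are kept in this scalar form so that only real-valued functions are ever
    differentiated or integrated. *)
Lemma dot_vderive_tangent (D : R -> Prop) (c : R -> R3) (t : R) (w : R3) :
  frenet_curve D c -> D t ->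
  dot (vderive (tangent c) t) w = len (vderive (tangent c) t) * dot (normal c t) w.
Proof.
  intros F Dt; apply dot_normalize_l; now apply vderive_tangent_neq0 with D.
Qed.

(** Differentiating [dot T T = 1] gives twice [len T' * dot N T = 0], and [len T'] is positive. *)
Lemma tangent_normal_orthogonal (D : R -> Prop) (oD : open D) (c : R -> R3) (t : R) :
  frenet_curve D c -> D t -> dot (tangent c t) (normal c t) = 0.
Proof.
  intros F Dt.
  pose proof (frenet_smooth_tangent D oD c F) as ST.
  pose proof (dot_derive_const D oD _ _ 1 t ST ST
                (fun x Dx => tangent_unit D c x F Dx) Dt) as E.
  pose proof (len_gt0 _ (vderive_tangent_neq0 D c t F Dt)) as L.
  rewrite (dotC (tangent c t)), !(dot_vderive_tangent D) in E by auto.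
  rewrite dotC; nra.
Qed.

Lemma dot_vderive_normal_tangent (D : R -> Prop) (oD : open D) (c : R -> R3) (t : R) :
  frenet_curve D c -> D t ->
  dot (vderive (normal c) t) (tangent c t) = - len (vderive (tangent c) t).
Proof.
  intros F Dt.
  pose proof (dot_derive_const D oD _ _ 0 t (frenet_smooth_tangent D oD c F)
                (frenet_smooth_normal D oD c F)
                (fun x Dx => tangent_normal_orthogonal D oD c x F Dx) Dt) as E.
  rewrite (dot_vderive_tangent D), (normal_unit D) in E by auto.
  rewrite dotC; lra.
Qed.

(** The indicatrix is regular since [T'] does not vanish. Its curvature is non-zero because its unit
    tangent is [N], and [N'] has the non-zero component [- len T'] along [T]. *)
Lemma frenet_curve_tangent (D : R -> Prop) (oD : open D) (c : R -> R3) :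
  frenet_curve D c -> frenet_curve D (tangent c).
Proof.
  intros F; split; [|split].
  - now apply frenet_smooth_tangent.
  - intros t Dt; now apply vderive_tangent_neq0 with D.
  - intros t Dt.
    pose proof (len_gt0 _ (vderive_tangent_neq0 D c t F Dt)) as L.
    change (len (vderive (normal c) t) / len (vderive (tangent c) t) <> 0).
    assert (L' : 0 < len (vderive (normal c) t)).
    { apply len_gt0; intros E.
      pose proof (dot_vderive_normal_tangent D oD c t F Dt) as H.
      rewrite E, dotC, dot0r in H; lra. }
    apply Rgt_not_eq; now apply Rdiv_lt_0_compat.
Qed.

Lemma frenet_smooth_binormal (D : R -> Prop) (oD : open D) (c : R -> R3) :
  frenet_curve D c -> smooth D (binormal c).
Proof.
  intros F; apply smooth_cross; auto.
  - now apply frenet_smooth_tangent.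
  - now apply frenet_smooth_normal.
Qed.

Lemma frenet_expansion (D : R -> Prop) (oD : open D) (c : R -> R3) (t : R) (v w : R3) :
  frenet_curve D c -> D t ->
  dot v w = dot v (tangent c t) * dot w (tangent c t)
            + dot v (normal c t) * dot w (normal c t)
            + dot v (binormal c t) * dot w (binormal c t).
Proof.
  intros F Dt; apply orthonormal_expansion.
  - now apply (tangent_unit D).
  - now apply (normal_unit D).
  - now apply (tangent_normal_orthogonal D).
Qed.

(** Third Frenet equation: [B'] is parallel to [N]. Differentiating [dot B T = 0] and [dot B B = 1]
    kills its other two components, as [T'] is parallel to [N]. *)
Lemma dot_vderive_binormal (D : R -> Prop) (oD : open D) (c : R -> R3) (t : R) (w : R3) :
  frenet_curve D c -> D t ->
  dot (vderive (binormal c) t) w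
  = dot (vderive (binormal c) t) (normal c t) * dot (normal c t) w.
Proof.
  intros F Dt.
  pose proof (frenet_smooth_binormal D oD c F) as SB.
  pose proof (dot_derive_const D oD _ _ 0 t SB (frenet_smooth_tangent D oD c F)
                (fun x Dx => dot_cross_l _ _) Dt) as ET.
  assert (BB : forall x, D x -> dot (binormal c x) (binormal c x) = 1).
  { intros x Dx; apply dot_cross_cross.
    - now apply (tangent_unit D).
    - now apply (normal_unit D).
    - now apply (tangent_normal_orthogonal D). }
  pose proof (dot_derive_const D oD _ _ 1 t SB SB BB Dt) as EB.
  assert (BN : dot (binormal c t) (normal c t) = 0) by apply dot_cross_r.
  rewrite (dotC (binormal c t)), (dot_vderive_tangent D) in ET by auto.
  rewrite (dotC (normal c t)), BN in ET.
  rewrite (dotC (binormal c t)) in EB.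
  rewrite (frenet_expansion D oD c t _ w F Dt).
  replace (dot (vderive (binormal c) t) (tangent c t)) with 0 by lra.
  replace (dot (vderive (binormal c) t) (binormal c t)) with 0 by lra.
  rewrite (dotC w (normal c t)); ring.
Qed.

Lemma dot_vderive_normal_binormal (D : R -> Prop) (oD : open D) (c : R -> R3) (t : R) :
  frenet_curve D c -> D t ->
  dot (vderive (normal c) t) (binormal c t)
  = - dot (vderive (binormal c) t) (normal c t).
Proof.
  intros F Dt.
  pose proof (dot_derive_const D oD _ _ 0 t (frenet_smooth_binormal D oD c F)
                (frenet_smooth_normal D oD c F)
                (fun x Dx => dot_cross_r _ _) Dt) as E.
  rewrite (dotC (binormal c t)) in E; lra.
Qed.

(** The speed cancels, leaving an expression in the derivatives of the frame alone. *)
Lemma torsion_curvature_ratio (D : R -> Prop) (c : R -> R3) (t : R) :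
  frenet_curve D c -> D t ->
  torsion c t / curvature c t
  = - dot (vderive (binormal c) t) (normal c t) / len (vderive (tangent c) t).
Proof.
  intros F Dt.
  pose proof (len_gt0 _ (vderive_tangent_neq0 D c t F Dt)).
  destruct F as (_ & reg & _); pose proof (len_gt0 _ (reg t Dt)).
  unfold torsion, curvature, speed; field; lra.
Qed.

(** * Lancret's theorem *)

Lemma open_oint (a b : Rbar) : open (oint a b).
Proof. apply open_and; [apply open_Rbar_gt | apply open_Rbar_lt]. Qed.

Lemma oint_nonempty (a b : Rbar) : Rbar_lt a b -> exists t, oint a b t.
Proof.
  unfold oint; destruct a as [a| |], b as [b| |]; simpl; intros H; try easy.
  - exists ((a + b) / 2); lra.
  - exists (a + 1); lra.
  - exists (b - 1); lra.
  - exists 0; easy.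
Qed.

Lemma oint_convex (a b : Rbar) (s t x : R) :
  oint a b s -> oint a b t -> s <= x <= t -> oint a b x.
Proof.
  unfold oint; destruct a, b; simpl; intros; intuition lra.
Qed.

Lemma derive0_const (a b : Rbar) (f : R -> R) (s t : R) :
  (forall x, oint a b x -> is_derive f x 0) -> oint a b s -> oint a b t -> f s = f t.
Proof.
  intros H.
  assert (L : forall s t, oint a b s -> oint a b t -> s < t -> f s = f t).
  { intros p q Dp Dq lt; apply (eq_is_derive (V := R_NormedModule)); auto.
    intros x Hx; apply H; now apply oint_convex with p q. }
  intros Ds Dt; destruct (Rtotal_order s t) as [lt|[->|lt]]; auto.
  symmetry; auto.
Qed.

(** The parameter is arbitrary because the lemma is applied to a tangent indicatrix. A constant
    ratio makes a combination of [T] and [B] a fixed axis; conversely, differentiating [dot T u = k]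
    twice gives a linear relation between the coefficients of [T'] and [B']. *)
Lemma Lancret (a b : Rbar) (c : R -> R3) :
  Rbar_lt a b -> frenet_curve (oint a b) c ->
  (general_helix (oint a b) c <->
   exists (u : R3) (k : R),
     u <> zero /\ forall t, oint a b t -> dot (tangent c t) u = k).
Proof.
  intros hab F.
  set (D := oint a b) in *.
  assert (oD : open D) by apply open_oint.
  destruct (oint_nonempty a b hab) as [t0 Dt0]; fold D in Dt0.
  pose proof (frenet_smooth_tangent D oD c F) as ST.
  pose proof (frenet_smooth_normal D oD c F) as SN.
  pose proof (frenet_smooth_binormal D oD c F) as SB.
  assert (pos : forall t, D t -> 0 < len (vderive (tangent c) t)).
  { intros t Dt; apply len_gt0; now apply vderive_tangent_neq0 with D. }
  split.
  - (* The axis is [k T + B]: its derivative is [(k p - q) N], where [T' = p N]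
       and [B' = - q N]. *)
    intros [k Hk].
    assert (BN : forall t, D t -> dot (vderive (binormal c) t) (normal c t)
                                  = - k * len (vderive (tangent c) t)).
    { intros t Dt; rewrite <- (Hk t Dt), (torsion_curvature_ratio D) by auto.
      field; apply Rgt_not_eq, pos, Dt. }
    set (axis := fun t => plus (scal k (tangent c t)) (binormal c t)).
    (* Constancy of the axis is tested against each fixed [w], which reduces it to a scalar function
       with zero derivative. *)
    assert (Cst : forall w s t, D s -> D t -> dot (axis s) w = dot (axis t) w).
    { intros w s t; apply (derive0_const a b (fun x => dot (axis x) w)).
      intros x Dx.
      apply is_derive_ext with
        (fun x => k * dot (tangent c x) w + dot (binormal c x) w).
      { intros y; unfold axis; now rewrite dot_plus_l, dot_scal_l. }
      pose proof (is_derive_dot D _ _ x ST (smooth_const D w) Dx) as dT.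
      pose proof (is_derive_dot D _ _ x SB (smooth_const D w) Dx) as dB.
      rewrite vderive_const, dot0r in dT, dB.
      rewrite (dot_vderive_tangent D) in dT by auto.
      rewrite (dot_vderive_binormal D oD c x w F Dx), BN in dB by auto.
      evar_last.
      { apply @is_derive_plus; [|exact dB].
        apply is_derive_scal; exact dT. }
      unfold plus; simpl; ring. }
    assert (TB : forall t, dot (binormal c t) (tangent c t) = 0)
      by (intros t; apply dot_cross_l).
    exists (axis t0), k; split.
    (* The axis is non-zero because its component along [B] is 1. *)
    + intros E.
      assert (BB : dot (binormal c t0) (binormal c t0) = 1).
      { apply dot_cross_cross.
        - now apply (tangent_unit D).
        - now apply (normal_unit D).
        - now apply (tangent_normal_orthogonal D). }
      assert (E' : dot (axis t0) (binormal c t0) = 0)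
        by (rewrite E, dotC; apply dot0r).
      unfold axis in E'; rewrite dot_plus_l, dot_scal_l, BB, dotC, TB in E'; lra.
    + intros t Dt; rewrite dotC, (Cst (tangent c t) t0 t Dt0 Dt).
      unfold axis; rewrite dot_plus_l, dot_scal_l, TB, (tangent_unit D) by auto.
      ring.
  - intros (u & k & nz & Hu).
    (* First differentiation of [dot T u = k]; since [B'] is parallel to [N], it also makes
       [dot B u] constant. *)
    assert (Nu : forall t, D t -> dot (normal c t) u = 0).
    { intros t Dt.
      pose proof (dot_derive_const D oD _ _ k t ST (smooth_const D u) Hu Dt) as E.
      rewrite vderive_const, dot0r, (dot_vderive_tangent D) in E by auto.
      pose proof (pos t Dt); nra. }
    assert (Bu : forall t, D t -> dot (binormal c t) u = dot (binormal c t0) u).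
    { intros t Dt; apply (derive0_const a b (fun x => dot (binormal c x) u)); auto.
      intros x Dx.
      pose proof (is_derive_dot D _ _ x SB (smooth_const D u) Dx) as dB.
      rewrite vderive_const, dot0r in dB.
      rewrite (dot_vderive_binormal D oD c x u F Dx), Nu in dB by auto.
      now rewrite Rmult_0_r, Rplus_0_r in dB. }
    set (d := dot (binormal c t0) u) in *.
    (* Second differentiation: [dot N' u = 0], expanded in the Frenet frame. *)
    assert (R : forall t, D t -> - dot (vderive (binormal c) t) (normal c t) * d
                                 = len (vderive (tangent c) t) * k).
    { intros t Dt.
      pose proof (dot_derive_const D oD _ _ 0 t SN (smooth_const D u) Nu Dt) as E.
      rewrite vderive_const, dot0r in E.
      rewrite (frenet_expansion D oD c t _ u F Dt) in E.
      rewrite (dot_vderive_normal_tangent D), (dot_vderive_normal_binormal D) in E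
        by auto.
      rewrite !(dotC u), Hu, Nu, Bu in E by auto.
      lra. }
    (* If [d] vanished, the relation would force [k = 0], and [u] would be orthogonal to the whole
       frame. *)
    assert (d0 : d <> 0).
    { intros E; specialize (R t0 Dt0); rewrite E in R.
      pose proof (pos t0 Dt0); assert (k = 0) by nra.
      apply nz, dot_eq0; rewrite (frenet_expansion D oD c t0 u u F Dt0).
      rewrite !(dotC u), Hu, Nu by auto; fold d; rewrite E; nra. }
    (* Up to sign, the cotangent of the angle between the tangent and the axis. *)
    exists (k / d); intros t Dt.
    rewrite (torsion_curvature_ratio D) by auto.
    pose proof (pos t Dt); specialize (R t Dt).
    apply Rmult_eq_reg_r with (len (vderive (tangent c) t) * d).
    + field_simplify; lra.
    + apply Rmult_integral_contrapositive; split; lra.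
Qed.

(** * Slant helices *)

(** The angle between lines determines only the absolute value of [dot N u]. Its square is constant,
    and differentiability on an interval excludes a change of sign. *)
Lemma slant_helix_dot (a b : Rbar) (c : R -> R3) :
  Rbar_lt a b -> frenet_curve (oint a b) c ->
  (slant_helix (oint a b) c <->
   exists (u : R3) (k : R),
     u <> zero /\ forall t, oint a b t -> dot (normal c t) u = k).
Proof.
  intros hab F.
  assert (oD : open (oint a b)) by apply open_oint.
  assert (N1 : forall t, oint a b t -> len (normal c t) = 1).
  { intros t Dt; unfold len; rewrite (normal_unit (oint a b)) by auto.
    apply sqrt_1. }
  split.
  - intros (_ & u & theta & nz & H).
    pose proof (len_gt0 u nz) as L.
    assert (A : forall t, oint a b t ->
                  Rabs (dot (normal c t) u) = cos theta * len u).
    { intros t Dt; rewrite <- (H t Dt); unfold line_angle; rewrite N1 by auto.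
      pose proof (Cauchy_Schwarz (normal c t) u) as CS; rewrite N1 in CS by auto.
      pose proof (Rabs_pos (dot (normal c t) u)).
      (* The argument of [acos] lies between -1 and 1 by the Cauchy-Schwarz inequality. *)
      rewrite cos_acos; [field; lra|].
      split.
      - apply Rle_trans with 0; [lra|]; apply Rdiv_le_0_compat; lra.
      - apply Rle_div_l; lra. }
    set (K := cos theta * len u) in *.
    assert (Sq : forall t, oint a b t ->
                   dot (normal c t) u * dot (normal c t) u = K * K).
    { intros t Dt; rewrite <- (A t Dt).
      apply Rsqr_abs. }
    destruct (oint_nonempty a b hab) as [t0 Dt0].
    exists u, (dot (normal c t0) u); split; auto.
    intros t Dt; destruct (Req_dec K 0) as [K0|K0].
    { assert (Z : forall x, oint a b x -> dot (normal c x) u = 0).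
      { intros x Dx; apply Rsqr_0_uniq; unfold Rsqr; rewrite Sq, K0 by auto; ring. }
      now rewrite !Z. }
    apply (derive0_const a b (fun x => dot (normal c x) u)); auto.
    intros x Dx.
    pose proof (is_derive_dot _ _ _ x (frenet_smooth_normal _ oD c F)
                  (smooth_const _ u) Dx) as dN.
    rewrite vderive_const, dot0r, Rplus_0_r in dN.
    enough (E : dot (vderive (normal c) x) u = 0) by now rewrite E in dN.
    assert (dN' : Derive (fun x => dot (normal c x) u) x
                  = dot (vderive (normal c) x) u) by now apply is_derive_unique.
    (* The constant square has derivative [2 * dot N u * dot N' u], and the factor [dot N u] is
       non-zero when [K] is. *)
    assert (E : Derive (fun x => dot (normal c x) u * dot (normal c x) u) x = 0).
    { rewrite <- (Derive_const (K * K) x); apply Derive_ext_loc.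
      generalize (oD x Dx); now apply filter_imp. }
    rewrite Derive_mult, dN' in E by (eexists; exact dN).
    assert (dot (normal c x) u <> 0).
    { intros Z; apply K0, Rsqr_0_uniq; unfold Rsqr.
      rewrite <- (Sq x Dx), Z; ring. }
    apply Rmult_eq_reg_r with (dot (normal c x) u); lra.
  - intros (u & k & nz & H); split; auto.
    (* The factor 1 is the length of the normal. *)
    exists u, (acos (Rabs k / (1 * len u))); split; auto.
    intros t Dt; unfold line_angle; now rewrite H, N1.
Qed.

Lemma slant_helix_iff_spherical_helix (a b : Rbar) (c : R -> R3) :
  Rbar_lt a b -> frenet_curve (oint a b) c ->
  (slant_helix (oint a b) c <->
   spherical_helix (oint a b) (tangent_indicatrix c)).
Proof.
  intros hab F.
  pose proof (frenet_curve_tangent _ (open_oint a b) c F) as FT.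
  rewrite slant_helix_dot by auto.
  transitivity (general_helix (oint a b) (tangent c)).
  - (* [normal c] is convertible to [tangent (tangent c)] *)
    symmetry; exact (Lancret a b (tangent c) hab FT).
  - split; [|now intros (_ & _ & H)].
    intros H; split; [exact FT|]; split; [|exact H].
    intros t Dt; unfold len, tangent_indicatrix.
    rewrite (tangent_unit (oint a b)) by auto; apply sqrt_1.
Qed.

(** * Transfer between a Bertrand curve and its mate *)

Lemma line_angle_scal_sign (eps : R) (u v : R3) :
  eps = 1 \/ eps = -1 -> line_angle (scal eps u) v = line_angle u v.
Proof.
  intros He; unfold line_angle, len.
  rewrite !dot_scal_l, (dotC u (scal eps u)), dot_scal_l, Rabs_mult.
  assert (Rabs eps = 1)
    by (unfold Rabs; destruct Rcase_abs, He; lra).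
  assert (eps * (eps * dot u u) = dot u u) as -> by (destruct He; subst; ring).
  now rewrite H, Rmult_1_l.
Qed.

(** The same axis and the same angle serve both curves. *)
Lemma bertrand_slant_helix (D E : R -> Prop) (c m : R -> R3) :
  frenet_curve D c -> frenet_curve E m -> bertrand_pair D c E m ->
  (slant_helix D c <-> slant_helix E m).
Proof.
  intros Fc Fm (phi & lambda & eps & Hphi & Hsurj & _ & He & HN & _).
  assert (A : forall u s, D s ->
    line_angle (normal c s) u = line_angle (normal m (phi s)) u).
  { intros u s Ds; rewrite HN by auto; now apply line_angle_scal_sign. }
  split; intros (_ & u & theta & nz & H); (split; [assumption|]);
    exists u, theta; (split; [exact nz|]).
  (* Every point of the mate corresponds to a point of [c], so the angle condition reaches all of
     [E]. *)
  - intros t Et; destruct (Hsurj t Et) as (s & [Ds <-] & _).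
    rewrite <- A; auto.
  - intros s Ds; rewrite A; auto.
Qed.

Theorem theorem5 (a b a' b' : Rbar) (gamma mate : R -> R3)
  (hab : Rbar_lt a b) (hab' : Rbar_lt a' b')
  (gamma_curve : frenet_curve (oint a b) gamma)
  (mate_curve : frenet_curve (oint a' b') mate)
  (gamma_arclength : unit_speed (oint a b) gamma)
  (mate_arclength : unit_speed (oint a' b') mate)
  (bertrand : bertrand_pair (oint a b) gamma (oint a' b') mate)
  (gamma_non_helical : ~ general_helix (oint a b) gamma)
  (mate_non_helical : ~ general_helix (oint a' b') mate)
  (gamma_non_planar : non_planar (oint a b) gamma)
  (mate_non_planar : non_planar (oint a' b') mate)
  (gamma_quotients : admissible_quotients (oint a b) gamma)
  (mate_quotients : admissible_quotients (oint a' b') mate) :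
  (slant_helix (oint a b) gamma <->
     spherical_helix (oint a b) (tangent_indicatrix gamma)) /\
  (slant_helix (oint a' b') mate <->
     spherical_helix (oint a b) (tangent_indicatrix gamma)).
Proof.
  (* Slant helicity of the mate becomes that of [gamma], which turns both claims into the same
     equivalence. *)
  rewrite <- (bertrand_slant_helix _ _ _ _ gamma_curve mate_curve bertrand).
  split; now apply slant_helix_iff_spherical_helix.
Qed.
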